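(* Let $m\ge p\ge 1$, let $\Psi:\mathbb{R}^m\to\mathbb{R}^p$ be a real polynomial map and let $V:=\Psi^{-1}(0)$. If $\mathrm{Sing}(\Psi)\cap V$ is bounded, then $\overline{M(\Psi)\setminus V}\cap V$ is bounded.
   Context: $\mathrm{Sing}(\Psi)$ is the set of points where the differential of $\Psi$ has rank $<p$. The Milnor set $M(\Psi)$ is the set of points $x\in\mathbb{R}^m$ at which the Euclidean distance function and $\Psi$ are not transversal, i.e. at which the map $(\|x\|^2,\Psi):\mathbb{R}^m\to\mathbb{R}\times\mathbb{R}^p$ is not a submersion; in particular $\mathrm{Sing}(\Psi)\subset M(\Psi)$. The closure is taken in $\mathbb{R}^m$. *)

(* Defs.v *)
From mathcomp Require Import all_boot all_order all_algebra.
From mathcomp Require Import all_classical all_reals all_analysis.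
(* [mpoly] is not imported: its notations clash with those of
   MathComp-Analysis, hence the qualified names below. *)
From mathcomp Require mpoly.

Set Implicit Arguments.
Unset Strict Implicit.
Unset Printing Implicit Defensive.

Import Order.TTheory GRing.Theory Num.Theory.
Import numFieldNormedType.Exports.

Local Open Scope classical_set_scope.
Local Open Scope ring_scope.

(* R^n is ['rV[R]_n]; its library norm is the sup norm, which induces the usual
   topology and the usual bounded sets.  The Euclidean norm only enters through
   its square [sqnorm2]. *)

Section PolynomialMaps.
Variables (R : realType) (m p : nat).
Implicit Type Psi : 'rV[R]_m -> 'rV[R]_p.

Definition polynomial_map Psi : Prop :=
  exists P : 'I_p -> mpoly.mpoly m R,
    forall x i, Psi x 0 i = mpoly.meval (fun j => x 0 j) (P i).

Definition Sing Psi : set 'rV[R]_m :=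
  [set x | (\rank (jacobian Psi x) < p)%N].

Definition sqnorm2 (x : 'rV[R]_m) : R := \sum_(i < m) x 0 i ^+ 2.

Definition submersion_at (W : normedModType R) (f : 'rV[R]_m -> W)
    (x : 'rV[R]_m) : Prop :=
  differentiable f x /\ (forall w : W, exists v : 'rV[R]_m, 'd f x v = w).

Definition Milnor_set Psi : set 'rV[R]_m :=
  [set x | ~ submersion_at (fun y => (sqnorm2 y, Psi y)) x].

End PolynomialMaps.

(* Main.v *)
(** A point of [M(Psi)] on [V] away from [Sing(Psi)] is a critical point of
    [|x|^2] restricted to [V]. Suppose that such points [x_n] tend to infinity,
    and regard them as a single point [x] with hyperreal coordinates, that is,
    modulo an ultrafilter [U]. Then [t = |x|^2] is infinite, hence transcendental
    over [R], so some derivation [D] over [R] has [D t = 1]; as the characteristic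
    is zero, [D] extends to the coordinates of [x]. Applying it to [Psi(x) = 0]
    gives [d Psi(Dx) = 0], and since the gradient of [|x|^2] is a combination of
    the gradients of the components of [Psi], [D t = 0], a contradiction. So
    [M(Psi)] meets [V] in a bounded set; as [M(Psi)] is closed (it is the zero
    set of a Gram determinant), this bounds the closure as well. *)
Require Import Defs.
From HB Require Import structures.
From mathcomp Require Import all_boot all_order all_algebra.
From mathcomp Require Import all_classical all_reals all_analysis.
From mathcomp Require Import ring lra zify.
From mathcomp Require mpoly.
(* The notations of [mpoly] clash with those of MathComp-Analysis. *)
Import -(notations) mpoly.

Set Implicit Arguments.
Unset Strict Implicit.
Unset Printing Implicit Defensive.

Import Order.TTheory GRing.Theory Num.Theory.
Import numFieldNormedType.Exports.

Local Open Scope classical_set_scope.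
Local Open Scope ring_scope.

(** * Rings of hyperreals with a derivation, modulo an ultrafilter *)

(* [model_ring] stands for a finitely generated [R]-algebra of hyperreals, with
   [ev i] and [der i] the [i]-th representatives of an element and of its
   derivative. An element is zero when [ev i f = 0] for [U]-almost all [i]; by
   [der_ae0] the derivation respects this, so that no quotient ring or fraction
   field has to be formed. *)
Record derivation_model (R : numFieldType) (T : Type) (U : set_system T) :=
  DerivationModel {
    model_ring :> comNzRingType;
    const : {rmorphism R -> model_ring};
    ev : T -> {rmorphism model_ring -> R};
    der : T -> {additive model_ring -> R};
    ev_const : forall i c, ev i (const c) = c;
    der_const : forall i c, der i (const c) = 0;
    derM : forall i f g, der i (f * g) = ev i f * der i g + der i f * ev i g;
    der_ae0 : forall f, U [set i | ev i f = 0] -> U [set i | der i f = 0] }.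

Lemma ultra_neq0 (R : numFieldType) (T : Type) (U : set_system T)
    (s : T -> R) : UltraFilter U ->
  ~ U [set i | s i = 0] -> U [set i | s i != 0].
Proof.
move=> UU; have [//|Us _] := in_ultra_setVsetC [set i | s i = 0] UU.
by apply: filterS Us => i /eqP.
Qed.

(** A filter is closed under finite intersections only; as the coefficients past the size are 0,
    finitely many conditions remain. *)
Lemma near_forall_coef (T : Type) (U : set_system T) {FU : Filter U}
    (A : nzRingType) (P : T -> A -> Prop) (f : {poly A}) :
  (forall i, P i 0) -> (forall k, U [set i | P i f`_k]) ->
  U [set i | forall k, P i f`_k].
Proof.
move=> P0 Pf.
have : \forall i \near U, forall k : 'I_(size f), P i f`_k.
  by apply: filter_forall => k; exact: Pf.
apply: filterS => i Pi k; have [ltkf|/leq_sizeP/(_ k)->//] := ltnP k (size f).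
exact: Pi (Ordinal ltkf).
Qed.

(** * Adjoining one hyperreal to a model *)

Section Adjoin.
Variables (R : numFieldType) (T : Type) (U : set_system T).
Context {UU : UltraFilter U}.
Variables (A : derivation_model R U) (a : T -> R).

Definition adjoin_ev (i : T) : {poly A} -> R :=
  horner_eval (a i) \o map_poly (ev A i).

HB.instance Definition _ i := GRing.RMorphism.on (adjoin_ev i).

(** The derivation over [adjoin_ev i] that extends [der A i] and sends ['X] to [v i]. *)
Definition adjoin_der (v : T -> R) (i : T) (f : {poly A}) : R :=
  (map_poly (der A i) f).[a i] + v i * (map_poly (ev A i) f)^`().[a i].

Lemma adjoin_der_is_additive v i : zmod_morphism (adjoin_der v i).
Proof. by move=> f g; rewrite /adjoin_der !(raddfB, hornerE) /=; ring. Qed.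

HB.instance Definition _ v i :=
  GRing.isZmodMorphism.Build _ _ (adjoin_der v i) (adjoin_der_is_additive v i).

Lemma map_poly_derM i (f g : {poly A}) :
  map_poly (der A i) (f * g) = map_poly (ev A i) f * map_poly (der A i) g
                             + map_poly (der A i) f * map_poly (ev A i) g.
Proof.
apply/polyP => k; rewrite coefD !coefM coef_map coefM raddf_sum -big_split /=.
by apply: eq_bigr => j _; rewrite derM !coef_map.
Qed.

Lemma adjoin_derM v i (f g : {poly A}) :
  adjoin_der v i (f * g) =
  adjoin_ev i f * adjoin_der v i g + adjoin_der v i f * adjoin_ev i g.
Proof.
rewrite /adjoin_der /adjoin_ev /= /horner_eval map_poly_derM rmorphM derivM.
by rewrite !hornerE; ring.
Qed.

Lemma adjoin_evC i c : adjoin_ev i c%:P = ev A i c.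
Proof. by rewrite /adjoin_ev /= /horner_eval map_polyC hornerC. Qed.

Lemma adjoin_evX i : adjoin_ev i 'X = a i.
Proof. by rewrite /adjoin_ev /= /horner_eval map_polyX hornerX. Qed.

Lemma adjoin_derC v i c : adjoin_der v i c%:P = der A i c.
Proof. by rewrite /adjoin_der !map_polyC /= derivC horner0 hornerC mulr0 addr0. Qed.

Lemma adjoin_derX v i : adjoin_der v i 'X = v i.
Proof.
rewrite /adjoin_der map_polyX derivX hornerC mulr1.
have der1 : der A i 1 = 0 by rewrite -(rmorph1 (const A)) der_const.
suff -> : map_poly (der A i) 'X = 0 by rewrite horner0 add0r.
apply/polyP => k; rewrite coef_map coefX coef0 /=.
by case: eqP => _; [exact: der1 | exact: raddf0].
Qed.

(** These are the polynomials that become zero over the quotient of [A] by its [U]-null elements. *)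
Definition null_coefs (f : {poly A}) := forall k, U [set i | ev A i f`_k = 0].

Lemma null_coefs_adjoin_der v f : null_coefs f ->
  U [set i | adjoin_der v i f = 0].
Proof.
move=> f0; have df0 k : U [set i | der A i f`_k = 0] by apply: der_ae0; exact: f0.
have evf0 : U [set i | forall k, ev A i f`_k = 0].
  by apply: (near_forall_coef (P := fun i c => ev A i c = 0)) f0 => i; exact: raddf0.
have derf0 : U [set i | forall k, der A i f`_k = 0].
  by apply: (near_forall_coef (P := fun i c => der A i c = 0)) df0 => i; exact: raddf0.
apply: filterS2 evf0 derf0 => i /= e d; rewrite /adjoin_der.
have -> : map_poly (der A i) f = 0.
  by apply/polyP => k; rewrite coef_map coef0; exact: d.
have -> : map_poly (ev A i) f = 0 by apply/polyP => k; rewrite coef_map coef0; exact: e.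
by rewrite deriv0 !horner0 mulr0 addr0.
Qed.

Definition compatible (v : T -> R) := forall f : {poly A},
  U [set i | adjoin_ev i f = 0] -> U [set i | adjoin_der v i f = 0].

Definition adjoin (v : T -> R) (hv : compatible v) : derivation_model R U.
Proof.
refine (@DerivationModel R T U {poly A} (polyC \o const A)
  (fun i => adjoin_ev i) (fun i => adjoin_der v i) _ _ (adjoin_derM v) hv).
- by move=> i c /=; rewrite adjoin_evC ev_const.
- by move=> i c /=; rewrite adjoin_derC der_const.
Defined.

End Adjoin.

(** * Extending the derivation to an arbitrary hyperreal *)

Section Extension.
Variables (R : numFieldType) (T : Type) (U : set_system T).
Context {UU : UltraFilter U}.
Variables (A : derivation_model R U) (a : T -> R).

Local Notation ev' := (@adjoin_ev _ _ _ A a).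
Local Notation der' := (@adjoin_der _ _ _ A a).

Lemma transcendental_compatible v :
  (forall f : {poly A}, U [set i | ev' i f = 0] -> null_coefs f) ->
  compatible A a v.
Proof. by move=> ta f /ta; exact: null_coefs_adjoin_der. Qed.

(* For [p] of minimal size among the polynomials that vanish at [a] without
   vanishing identically, [a] must be sent to [v = - p^D(a) / p'(a)]; every other
   such polynomial is a pseudo-multiple of [p] modulo [U]. *)
Lemma algebraic_compatible (f : {poly A}) :
  U [set i | ev' i f = 0] -> ~ null_coefs f -> exists v, compatible A a v.
Proof.
move=> f0 nf.
pose relation n := `[< exists p : {poly A},
  [/\ size p = n, U [set i | ev' i p = 0] & ~ null_coefs p] >].
have exn : exists n, relation n by exists (size f); apply/asboolP; exists f.
have [n /asboolP[p [szp p0 np]] min_n] := find_ex_minn exn.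
have min_p (q : {poly A}) : (size q < size p)%N -> U [set i | ev' i q = 0] -> null_coefs q.
  rewrite szp ltnNge => szq q0; apply: contrapT => nq; move/negP: szq; apply.
  by apply: min_n; apply/asboolP; exists q.
have p_neq0 : p != 0.
  apply/eqP => p_eq0; apply: np => k; rewrite p_eq0 coef0.
  by apply: filterE => i /=; rewrite rmorph0.
(* A pseudo-division step: it cancels the top terms without dividing in [A]. *)
pose reduce (q : {poly A}) : {poly A} :=
  lead_coef p *: q - lead_coef q *: ('X^(size q - size p) * p).
have size_reduce (q : {poly A}) : (size p <= size q)%N -> (size (reduce q) < size q)%N.
  have p_gt0 : (0 < size p)%N by rewrite size_poly_gt0.
  move=> lepq; have q_gt0 := leq_trans p_gt0 lepq.
  rewrite -[X in (_ < X)%N](prednK q_gt0) ltnS.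
  apply/leq_sizeP => j; rewrite leq_eqVlt coefB !coefZ coefXnM.
  move=> /orP[/eqP<-|ltqj].
    rewrite ifN; last by lia.
    rewrite (_ : (_ - (_ - _))%N = (size p).-1); last by lia.
    by rewrite -!lead_coefE mulrC subrr.
  rewrite ifN; last by lia.
  have leqj : (size q <= j)%N by lia.
  have lepj : (size p <= j - (size q - size p))%N by lia.
  by rewrite (nth_default _ leqj) (nth_default _ lepj) !mulr0 subrr.
(* Otherwise [p] without its leading term would be a shorter relation, null by minimality, and [p]
   itself would be null. *)
have lc_neq0 : U [set i | ev A i (lead_coef p) != 0].
  apply: ultra_neq0 => lc0; apply: np.
  pose q := p - lead_coef p *: 'X^((size p).-1).
  have qE k : p`_k = q`_k + lead_coef p * (k == (size p).-1)%:R.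
    by rewrite !coefE subrK.
  have ltq : (size q < size p)%N.
    rewrite -[X in (_ < X)%N]prednK ?size_poly_gt0 // ltnS.
    apply/leq_sizeP => j; rewrite leq_eqVlt !coefE => /orP[/eqP<-|ltpj].
      by rewrite eqxx mulr1 subrr.
    rewrite gtn_eqF // mulr0 subr0 nth_default //.
    by rewrite -[size p]prednK // size_poly_gt0.
  have q0 : U [set i | ev' i q = 0].
    apply: filterS2 p0 lc0 => i /= pi lci.
    by rewrite /q -mul_polyC rmorphB rmorphM /= adjoin_evC pi lci mul0r subrr.
  move=> k; apply: filterS2 (min_p _ ltq q0 k) lc0 => i /= qi lci.
  by rewrite qE rmorphD rmorphM /= qi lci mul0r addr0.
(* Were [p'(a)] zero, minimality would make [p'] null and, in characteristic zero, the leading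
   coefficient of [p] too. A constant [p] is its own leading coefficient and vanishes. *)
have dp_neq0 : U [set i | (map_poly (ev A i) p)^`().[a i] != 0].
  apply: ultra_neq0 => dp0.
  have {}dp0 : null_coefs p^`().
    apply: min_p; first exact: lt_size_deriv.
    by apply: filterS dp0 => i /=; rewrite deriv_map.
  suff /(filterI lc_neq0)/filter_ex[i [/eqP]//] :
    U [set i | ev A i (lead_coef p) = 0].
  case szpE : (size p) => [|[|s]].
  - by move/eqP: szpE; rewrite size_poly_eq0 (negPf p_neq0).
  - apply: filterS p0 => i /=.
    by rewrite lead_coefE szpE [p]size1_polyC ?szpE // adjoin_evC coefC.
  apply: filterS (dp0 s) => i /=; rewrite coef_deriv rmorphMn /= lead_coefE szpE.
  by move/eqP; rewrite mulrn_eq0 => /eqP.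
pose v i := - (map_poly (der A i) p).[a i] / (map_poly (ev A i) p)^`().[a i].
have der_p0 : U [set i | der' v i p = 0].
  apply: filterS dp_neq0 => i /= dpi.
  by rewrite /adjoin_der /v mulfVK // subrr.
exists v => q.
(* Below the size of [p], minimality applies. Above it, [reduce q] is shorter, and its derivative is
   that of [q] times the leading coefficient of [p], which can be cancelled. *)
elim: {q}_.+1 {-2}q (ltnSn (size q)) => // k IHk q.
rewrite ltnS => szq q0.
have [ltqp|lepq] := ltnP (size q) (size p).
  by apply: null_coefs_adjoin_der; exact: min_p.
have r0 : U [set i | ev' i (reduce q) = 0].
  apply: filterS2 p0 q0 => i /= pi qi.
  by rewrite /reduce -!mul_polyC rmorphB !rmorphM /= pi qi !mulr0 subrr.
have dr0 : U [set i | der' v i (reduce q) = 0].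
  by apply: IHk r0; apply: leq_trans (size_reduce _ lepq) _.
have pd0 : U [set i | ev A i (lead_coef p) != 0 /\ der' v i p = 0].
  exact: filterI.
apply: filterS3 pd0 p0 (filterI q0 dr0) => i [lci dpi] /= pi [/= qi].
rewrite /reduce -!mul_polyC raddfB /= !adjoin_derM rmorphM /= dpi pi qi !(mulr0, addr0) subr0.
by rewrite adjoin_evC => /eqP; rewrite mulf_eq0 (negPf lci) => /eqP.
Qed.

Lemma adjoin_exists :
  exists (B : derivation_model R U) (j : {rmorphism A -> B}) (b : B),
  [/\ forall i f, ev B i (j f) = ev A i f,
      forall i f, der B i (j f) = der A i f & forall i, ev B i b = a i].
Proof.
have [v hv] : exists v, compatible A a v.
  have [[f [f0 nf]]|tr] := pselect (exists f : {poly A},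
    U [set i | ev' i f = 0] /\ ~ null_coefs f).
    exact: algebraic_compatible f0 nf.
  (* Without an algebraic relation any derivative is allowed; 0 is an arbitrary choice. *)
  exists 0; apply: transcendental_compatible => f f0.
  by apply: contrapT => nf; apply: tr; exists f.
exists (adjoin hv), polyC, 'X; split=> i *; rewrite /=.
- exact: adjoin_evC.
- exact: adjoin_derC.
- exact: adjoin_evX.
Qed.

End Extension.

(** * Polynomials in several variables and their values in models *)

Lemma mpoly_ring_ind (n : nat) (R : nzRingType) (Q : mpoly n R -> Prop) :
  (forall c, Q (mpolyC n c)) -> (forall i, Q (mpolyX R (mnm1 i))) ->
  (forall f g, Q f -> Q g -> Q (f + g)) ->
  (forall f g, Q f -> Q g -> Q (f * g)) -> forall f, Q f.
Proof.
move=> QC QX QD QM; elim/mpolyind => [|c m f _ _ Qf]; first by rewrite -mpolyC0.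
apply: (QD) => //; rewrite -mul_mpolyC; apply: (QM) => //; rewrite mpolyXE_id.
apply: big_ind => // [|i _]; first by rewrite -mpolyC1.
by elim: (m i) => [|k Qk]; rewrite ?expr0 -?mpolyC1 // exprS; exact: QM.
Qed.

Section Tangent.
Variables (R : numFieldType) (T : Type) (U : set_system T).
Context {UU : UltraFilter U}.

Definition constant_model : derivation_model R U.
Proof.
refine (@DerivationModel R T U R idfun (fun=> idfun) (fun=> \0) _ _ _ _) => //=.
- by move=> _ f g; rewrite /= mulr0 mul0r addr0.
- by move=> f _; apply: filterE => i /=.
Defined.

Definition transcendental (t : T -> R) :=
  forall f : {poly R}, f != 0 -> ~ U [set i | f.[t i] = 0].

(** No nontrivial relation over the constants restricts the derivative of [t], so it may be
    prescribed as 1. *)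
Lemma transcendental_model (t : T -> R) : transcendental t ->
  exists (B : derivation_model R U) (s : B),
    forall i, ev B i s = t i /\ der B i s = 1.
Proof.
move=> tt; have ct : compatible constant_model t (fun=> 1).
  apply: transcendental_compatible => f f0 k.
  have [->|/tt[]] := eqVneq f 0.
    by apply: filterE => i /=; rewrite coef0.
  by apply: filterS f0 => i /=; rewrite /adjoin_ev /= /horner_eval map_poly_id.
exists (adjoin ct), 'X => i /=; split; [exact: adjoin_evX | exact: adjoin_derX].
Qed.

(** The elements are adjoined one at a time. Indexing by [nat] spares ordinal casts in the
    induction; nothing is claimed of [b] from index [k] on. *)
Lemma family_model (A : derivation_model R U) (k : nat) (x : nat -> T -> R) :
  exists (B : derivation_model R U) (j : {rmorphism A -> B}) (b : nat -> B),
  [/\ forall i f, ev B i (j f) = ev A i f,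
      forall i f, der B i (j f) = der A i f &
      forall l, (l < k)%N -> forall i, ev B i (b l) = x l i].
Proof.
elim: k => [|k [B [j [b [jev jder bx]]]]].
  by exists A, idfun, (fun=> 0).
have [C [j' [c [jev' jder' cx]]]] := adjoin_exists B (x k).
exists C, (j' \o j), (fun l => if l == k then c else j' (b l)).
split=> [i f|i f|l] /=; rewrite ?jev' ?jder' //.
rewrite ltnS leq_eqVlt => /orP[/eqP->|ltlk] i; first by rewrite eqxx.
by rewrite ltn_eqF // jev' bx.
Qed.

Lemma ev_mmap (B : derivation_model R U) (m : nat) (b : 'I_m -> B) i P :
  ev B i (mmap (const B) b P) = meval (fun j => ev B i (b j)) P.
Proof.
elim/mpoly_ring_ind: P => [c|j|f g Hf Hg|f g Hf Hg].
- by rewrite mmapC mevalC ev_const.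
- by rewrite mmapX mmap1U mevalXU.
- by rewrite !rmorphD /= Hf Hg.
- by rewrite !rmorphM /= Hf Hg.
Qed.

Lemma der_mmap (B : derivation_model R U) (m : nat) (b : 'I_m -> B) i P :
  der B i (mmap (const B) b P) =
  \sum_j meval (fun j => ev B i (b j)) (mderiv j P) * der B i (b j).
Proof.
elim/mpoly_ring_ind: P => [c|k|f g Hf Hg|f g Hf Hg].
- by rewrite mmapC der_const big1 // => j _; rewrite mderivC meval0 mul0r.
- rewrite mmapX mmap1U (bigD1 k) //= mderivX mnm1E eqxx scale1r mevalX.
  rewrite big1 => [|j _]; last by rewrite mnmBE subnn expr0.
  rewrite mul1r big1 ?addr0 // => j jk.
  by rewrite mderivX mnm1E eq_sym (negPf jk) scale0r meval0 mul0r.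
- rewrite rmorphD raddfD /= Hf Hg -big_split; apply: eq_bigr => j _.
  by rewrite raddfD /= mevalD mulrDl.
- rewrite rmorphM derM /= Hf Hg !ev_mmap mulr_sumr mulr_suml -big_split /=.
  by apply: eq_bigr => j _; rewrite mderivM mevalD !mevalM; ring.
Qed.

End Tangent.

(** An algebraic form of Sard's theorem. The multipliers [lambda] are used index by index only, so
    they need not be adjoined to the model. *)
Lemma critical_value_algebraic (R : numFieldType) (T : Type) (U : set_system T)
    (m p : nat) (P : 'I_p -> mpoly m R) (Q : mpoly m R)
    (x : T -> 'I_m -> R) (lambda : T -> 'I_p -> R) : UltraFilter U ->
  (forall k, U [set i | meval (x i) (P k) = 0]) ->
  U [set i | forall j, meval (x i) (mderiv j Q) =
               \sum_k lambda i k * meval (x i) (mderiv j (P k))] ->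
  ~ transcendental U (fun i => meval (x i) Q).
Proof.
move=> UU P0 Qcrit /transcendental_model[A [s sE]].
(* The default 0 is never reached: only indices below [m] are used. *)
have [B [j [b' [jev jder b'x]]]] := family_model A m
  (fun l i => if insub l is Some l' then x i l' else 0).
pose b (l : 'I_m) := b' l.
have bx i l : ev B i (b l) = x i l by rewrite b'x ?ltn_ord // valK.
have evb i f : ev B i (mmap (const B) b f) = meval (x i) f.
  by rewrite ev_mmap; apply: meval_eq.
pose D i f := \sum_l meval (x i) (mderiv l f) * der B i (b l).
have derb i f : der B i (mmap (const B) b f) = D i f.
  by rewrite der_mmap; apply: eq_bigr => l _; congr (_ * _); apply: meval_eq.
have DP0 : U [set i | forall k, D i (P k) = 0].
  apply: filter_forall => k; have : U [set i | ev B i (mmap (const B) b (P k)) = 0].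
    by apply: filterS (P0 k) => i /=; rewrite evb.
  by move/der_ae0; apply: filterS => i /=; rewrite derb.
(* [Q] at the point and [j s] may differ in [B] but have the same values; [der_ae0] on their
   difference gives them equal derivatives. *)
have DQ1 : U [set i | D i Q = 1].
  have : U [set i | ev B i (mmap (const B) b Q - j s) = 0].
    by apply: filterE => i /=; rewrite raddfB /= evb jev (sE i).1 subrr.
  move/der_ae0; apply: filterS => i /=.
  by rewrite raddfB /= derb jder (sE i).2 => /eqP; rewrite subr_eq0 => /eqP.
have [i [/= DPi [/= DQi Qi]]] := filter_ex (filterI DP0 (filterI DQ1 Qcrit)).
have : D i Q = \sum_k lambda i k * D i (P k).
  rewrite /D; under eq_bigr do rewrite Qi mulr_suml.
  rewrite exchange_big /=; apply: eq_bigr => k _.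
  by rewrite mulr_sumr; apply: eq_bigr => l _; rewrite mulrA.
rewrite DQi big1 => [/eqP|k _]; last by rewrite DPi mulr0.
by rewrite oner_eq0.
Qed.

(** * Differentials of polynomial maps *)

Section PolynomialCalculus.
Variables (R : realType) (m : nat).
Implicit Types (x v : 'rV[R]_m).

Definition mpeval (P : mpoly m R) x : R := meval (fun j => x 0 j) P.

(** Gradients are columns, the transpose of the usual Jacobian matrix, because the differential acts
    on row vectors. *)
Definition gradient k (P : 'I_k -> mpoly m R) : 'M[mpoly m R]_(m, k) :=
  \matrix_(j, i) mderiv j (P i).

Definition mxeval k l (M : 'M[mpoly m R]_(k, l)) x : 'M[R]_(k, l) :=
  map_mx (meval (fun j => x 0 j)) M.

Definition coordinate (j : 'I_m) x : R := x 0 j.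

Lemma coordinate_is_linear j : linear (coordinate j).
Proof. by move=> a x y; rewrite /coordinate !mxE. Qed.

HB.instance Definition _ j :=
  GRing.isLinear.Build _ _ _ _ (coordinate j) (coordinate_is_linear j).

Lemma is_diff_mpeval P x :
  is_diff x (mpeval P) (fun v => \sum_j v 0 j * mpeval (mderiv j P) x).
Proof.
elim/mpoly_ring_ind: P => [c|k|f g Hf Hg|f g Hf Hg].
- apply: is_diff_eq (_ : is_diff x (mpeval (mpolyC m c)) 0) _.
    rewrite (_ : mpeval _ = cst c); first exact: is_diff_cst.
    by apply/funext => y; rewrite /mpeval mevalC.
  by apply/funext => v; rewrite big1 // => j _; rewrite /mpeval mderivC meval0 mulr0.
- have cont_k : continuous (coordinate k) by exact: coord_continuous.
  apply: is_diff_eq (_ : is_diff x _ (coordinate k)) _.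
    rewrite (_ : mpeval _ = coordinate k).
      by apply: DiffDef; [exact: linear_differentiable | exact: diff_lin].
    by apply/funext => y; rewrite /mpeval mevalXU.
  apply/funext => v; rewrite (bigD1 k) //= /mpeval mderivX mnm1E eqxx scale1r mevalX.
  rewrite big1 => [|j _]; last by rewrite mnmBE subnn expr0.
  rewrite mulr1 big1 ?addr0 // => j jk.
  by rewrite mderivX mnm1E eq_sym (negPf jk) scale0r meval0 mulr0.
- rewrite (_ : mpeval (f + g) = mpeval f + mpeval g); last first.
    by apply/funext => y; exact: mevalD.
  apply: is_diff_eq (is_diffD Hf Hg) _; apply/funext => v.
  rewrite -[LHS]/(_ + _) -big_split; apply: eq_bigr => j _ /=.
  by rewrite -mulrDr /mpeval raddfD /= mevalD.
- rewrite (_ : mpeval (f * g) = mpeval f * mpeval g); last first.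
    by apply/funext => y; exact: mevalM.
  apply: is_diff_eq (is_diffM Hf Hg) _; apply/funext => v.
  rewrite /= -[LHS]/(mpeval f x * _ + mpeval g x * _).
  rewrite !mulr_sumr -big_split; apply: eq_bigr => j _.
  by rewrite /mpeval mderivM mevalD !mevalM /=; ring.
Qed.

Lemma mpeval_continuous P : continuous (mpeval P).
Proof.
by move=> x; apply: differentiable_continuous; case: (is_diff_mpeval P x).
Qed.

Lemma is_diff_sum (V W : normedModType R) k (f df : 'I_k -> V -> W) (x : V) :
  (forall i, is_diff x (f i) (df i)) ->
  is_diff x (\sum_i f i) (\sum_i df i).
Proof.
move=> Hf; apply: (big_ind2 (fun f df => is_diff x f df)) => //.
- exact: is_diff_cst.
- by move=> *; exact: is_diffD.
Qed.

Lemma is_diff_row_mpeval p (P : 'I_p -> mpoly m R) (Psi : 'rV[R]_m -> 'rV[R]_p) x :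
  (forall y i, Psi y 0 i = mpeval (P i) y) ->
  is_diff x Psi (mulmxr (mxeval (gradient P) x)).
Proof.
move=> PsiE; rewrite (_ : Psi = \sum_i ( *:%R^~ (delta_mx 0 i) \o mpeval (P i))).
  apply: is_diff_eq (is_diff_sum (fun i => is_diff_comp (is_diff_mpeval (P i) x)
    (is_diff_scalel _ _))) _.
  apply/funext => v; rewrite fct_sumE /= [RHS]row_sum_delta.
  apply: eq_bigr => i _; rewrite !mxE; congr (_ *: _).
  by apply: eq_bigr => j _; rewrite !mxE.
apply/funext => y; rewrite fct_sumE /= [LHS]row_sum_delta.
by apply: eq_bigr => i _; rewrite PsiE.
Qed.

Definition sqnorm_mpoly : mpoly m R := \sum_j mpolyX R (mnm1 j) ^+ 2.

Lemma sqnorm_mpolyE x : mpeval sqnorm_mpoly x = sqnorm2 x.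
Proof.
rewrite /mpeval raddf_sum; apply: eq_bigr => j _ /=.
by rewrite rmorphXn /= mevalXU.
Qed.

End PolynomialCalculus.

(** * Gram determinants, Lagrange multipliers and growth *)

Lemma mulmx_tr_eq0 (R : realDomainType) n (w : 'rV[R]_n) :
  w *m w^T = 0 -> w = 0.
Proof.
move=> /matrixP/(_ 0 0); rewrite !mxE => /eqP.
rewrite psumr_eq0 => [/allP w0|i _]; last by rewrite mxE -expr2 sqr_ge0.
apply/rowP => i; rewrite mxE; apply/eqP.
by have := w0 i (mem_index_enum _); rewrite mxE /= mulf_eq0 orbb.
Qed.

(** If [v] kills the Gram matrix, then [w = v M^T] has [w w^T = 0], a sum of squares, so [w = 0].
    Full rank thus becomes the nonvanishing of one polynomial in the entries. *)
Lemma row_full_gram (R : realType) m n (M : 'M[R]_(m, n)) :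
  row_full M = (\det (M^T *m M) != 0).
Proof.
rewrite -unitfE -unitmxE; apply/idP/idP => [fM|]; last first.
  rewrite -row_full_unit -!col_leq_rank => /leq_trans; apply.
  exact: mxrankM_maxr.
have {}fM : row_free M^T by rewrite /row_free mxrank_tr.
rewrite -row_free_unit; apply: inj_row_free => v vMM0.
apply/eqP; rewrite -(mulmx_free_eq0 _ fM); apply/eqP.
apply: mulmx_tr_eq0.
by rewrite trmx_mul trmxK mulmxA -(mulmxA v) vMM0 mul0mx.
Qed.

(** Lagrange multipliers: in a dependence between [g] and the independent columns of [J], the
    coefficient of [g] is nonzero and can be divided out. *)
Lemma row_full_row_mx (F : fieldType) m p (g : 'cV[F]_m) (J : 'M[F]_(m, p)) :
  row_full J -> ~~ row_full (row_mx g J) -> exists c, g = J *m c.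
Proof.
move=> fJ; have {}fJ : row_free J^T by rewrite /row_free mxrank_tr.
move=> nfull; apply: contrapT => noc; move/negP: nfull; apply.
rewrite /row_full -mxrank_tr tr_row_mx; apply: inj_row_free => c.
rewrite -[c]hsubmxK mul_row_col => /eqP.
set c0 := lsubmx c; set c1 := rsubmx c.
have c0E : c0 = (c0 0 0)%:M by exact: mx11_scalar.
rewrite {1}c0E mul_scalar_mx.
have [c00|c00] := eqVneq (c0 0 0) 0.
  rewrite c00 scale0r add0r (mulmx_free_eq0 _ fJ) => /eqP->.
  by rewrite c0E c00 raddf0 row_mx0.
rewrite addr_eq0 => /eqP cg; case: noc; exists (- (c0 0 0)^-1 *: c1^T).
apply: trmx_inj; rewrite -[LHS]scale1r -(mulVf c00) -scalerA cg.
by rewrite trmx_mul linearZ /= trmxK scalerN scaleNr mulNmx -scalemxAl.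
Qed.

(** Roots are split off one by one. This is what makes an infinite hyperreal transcendental. *)
Lemma poly_root_bound (R : realFieldType) (f : {poly R}) : f != 0 ->
  exists N, forall y, N < y -> f.[y] != 0.
Proof.
elim: {f}_.+1 {-2}f (ltnSn (size f)) => // k IHk f; rewrite ltnS => szf f0.
have [[r /factor_theorem[g fE]]|noroot] := pselect (exists r, root f r); last first.
  by exists 0 => y _; apply/negP => fy; apply: noroot; exists y.
have g0 : g != 0 by apply: contraNneq f0 => g0; rewrite fE g0 mul0r.
have [|N gN] := IHk g _ g0.
  by move: szf; rewrite fE size_Mmonic ?monicXsubC // size_XsubC addn2 /=.
exists (Num.max N r) => y; rewrite gt_max => /andP[ltNy ltry].
by rewrite fE hornerM hornerXsubC mulf_neq0 ?gN // subr_eq0 gt_eqF.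
Qed.

Lemma unbounded_setP (R : realType) (V : normedModType R) (A : set V) :
  ~ bounded_set A -> forall M : R, exists2 x, A x & M < `|x|.
Proof.
move=> nA M; apply: contrapT => nM; apply: nA.
exists M; split; first exact: num_real.
move=> N ltMN x Ax /=; apply: le_trans (ltW ltMN).
by rewrite leNgt; apply/negP => ltMx; apply: nM; exists x.
Qed.

(** The left side is the sup norm, in which boundedness is stated; a largest coordinate already
    gives the bound. *)
Lemma norm_le_sqnorm2 (R : realType) m (x : 'rV[R]_m) :
  `|x| <= 1 + sqnorm2 x.
Proof.
have sq_ge0 : 0 <= sqnorm2 x by apply: sumr_ge0 => j _; exact: sqr_ge0.
have [->|] := eqVneq `|x| 0; first by rewrite addr_ge0.
move=> /mx_norm_neq0[[i j]]; rewrite -[mx_norm x]/`|x| /= ord1 => ->.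
apply: (@le_trans _ _ (1 + x 0 j ^+ 2)).
  by rewrite -(real_normK (num_real (x 0 j))); nra.
rewrite lerD2l /sqnorm2 (bigD1 j) //= lerDl.
by apply: sumr_ge0 => k _; exact: sqr_ge0.
Qed.

(** * The Milnor set and its intersection with the zero fibre *)

Section MilnorSet.
Variables (R : realType) (m p : nat) (Psi : 'rV[R]_m -> 'rV[R]_p).
Variable P : 'I_p -> mpoly m R.
Hypothesis PsiE : forall x i, Psi x 0 i = mpeval (P i) x.

Definition sqnorm_jacobian : 'M[mpoly m R]_(m, 1 + p) :=
  row_mx (gradient (fun=> sqnorm_mpoly R m)) (gradient P).

(** Polynomial maps are differentiable everywhere, so only the surjectivity of the differential is
    at stake, and this is a rank condition. *)
Lemma Milnor_setE :
  Milnor_set Psi = [set x | ~~ row_full (mxeval sqnorm_jacobian x)].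
Proof.
apply/seteqP; suff subE x : submersion_at (fun y => (sqnorm2 y, Psi y)) x <->
    row_full (mxeval sqnorm_jacobian x).
  by split=> x /=; [move=> nsub; apply/negP => /subE | move=> /negP nfull /subE].
have sqE : @sqnorm2 R m = mpeval (sqnorm_mpoly R m).
  by apply/funext => y; rewrite sqnorm_mpolyE.
have [dF dFE] : is_diff x (fun y => (sqnorm2 y, Psi y))
    (fun v => (\sum_j v 0 j * mpeval (mderiv j (sqnorm_mpoly R m)) x,
               v *m mxeval (gradient P) x)).
  by rewrite sqE; apply: is_diff_pair; [exact: is_diff_mpeval|exact: is_diff_row_mpeval].
have mulE v : v *m mxeval sqnorm_jacobian x =
    row_mx (('d (fun y => (sqnorm2 y, Psi y)) x v).1)%:M
           ('d (fun y => (sqnorm2 y, Psi y)) x v).2.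
  rewrite dFE /mxeval map_row_mx mul_mx_row /=; congr row_mx.
  by apply/rowP => i; rewrite !mxE ord1 mulr1n; apply: eq_bigr => j _; rewrite !mxE.
split=> [[_ surj]|fullB].
  rewrite -sub1mx; apply/row_subP => i; apply/submxP.
  have [v vE] := surj ((lsubmx (row i 1%:M)) 0 0, rsubmx (row i 1%:M)).
  by exists v; rewrite mulE vE /= -mx11_scalar hsubmxK.
split=> // -[c r].
have /submxP[v vE] := submx_full (row_mx c%:M r) fullB.
exists v; move: vE; rewrite mulE => /eq_row_mx[/matrixP/(_ 0 0)].
by rewrite !mxE !mulr1n => -> ->; case: ('d _ x v).
Qed.

Lemma closed_Milnor_set : closed (Milnor_set Psi).
Proof.
pose gram := \det (sqnorm_jacobian^T *m sqnorm_jacobian).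
rewrite (_ : Milnor_set Psi = mpeval gram @^-1` [set 0]).
  by apply: preimage_closed; [move=> x _; exact: mpeval_continuous|exact: closed_eq].
have gramE x : mpeval gram x =
    \det ((mxeval sqnorm_jacobian x)^T *m mxeval sqnorm_jacobian x).
  by rewrite /mpeval -det_map_mx map_mxM map_trmx.
rewrite Milnor_setE; apply/seteqP; split=> x /=; rewrite row_full_gram gramE.
  by move/negPn/eqP.
by move=> ->; rewrite eqxx.
Qed.

Lemma SingE : Sing Psi = [set x | ~~ row_full (mxeval (gradient P) x)].
Proof.
apply/seteqP; suff jacE x : jacobian Psi x = mxeval (gradient P) x.
  by split=> x; rewrite /Sing /= jacE /row_full ltn_neqAle rank_leq_col andbT.
have [_ dE] := is_diff_row_mpeval x PsiE.
by apply/matrixP => i j; rewrite mxE dE /= -rowE mxE.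
Qed.

Lemma bounded_Milnor_fiber :
  bounded_set (Sing Psi `&` Psi @^-1` [set 0]) ->
  bounded_set (Milnor_set Psi `&` Psi @^-1` [set 0]).
Proof.
move=> /pinfty_ex_gt0[M0 M0_gt0 singM0]; apply: contrapT => /unbounded_setP unb.
(* Adding [M0] keeps every [x n] outside [Sing Psi], so that multipliers exist for all [n]. *)
have /choice[x xP] : forall n : nat, exists x, (Milnor_set Psi `&` Psi @^-1` [set 0]) x /\
    M0 + n%:R < `|x|.
  by move=> n; have [x ? ?] := unb (M0 + n%:R); exists x.
have /choice[lam lamE] : forall n, exists c : 'cV[R]_p,
    mxeval (gradient (fun=> sqnorm_mpoly R m)) (x n) =
    mxeval (gradient P) (x n) *m c :> 'cV[R]_m.
  move=> n; have [[Mx Vx] ltx] := xP n; apply: row_full_row_mx.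
    apply/negPn/negP => Sx; have : `|x n| <= M0 by apply: singM0; split; rewrite ?SingE.
    by rewrite leNgt (le_lt_trans _ ltx) // lerDl.
  by move: Mx; rewrite Milnor_setE /= /mxeval map_row_mx.
(* An ultrafilter finer than [eventually], so that [x] still tends to infinity along it. *)
have [U [UU evU]] := ultraFilterLemma (F := eventually) _.
apply: (@critical_value_algebraic R nat U m p P (sqnorm_mpoly R m)
  (fun n j => x n 0 j) (fun n k => lam n k 0)).
- move=> k; apply: filterE => n /=.
  have [[_ Vx] _] := xP n.
  by rewrite -[LHS]/(mpeval _ _) -PsiE Vx mxE.
- apply: filterE => n j /=; have /matrixP/(_ j 0) := lamE n.
  rewrite !mxE => ->; apply: eq_bigr => k _; rewrite !mxE mulrC; congr (_ * _).
- move=> f /poly_root_bound[N fN] f0.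
  have : U [set n | N < sqnorm2 (x n)].
    (* The [+ 1] makes up for the 1 in [norm_le_sqnorm2]. *)
    apply: evU; exists (Num.bound (`|N| + 1)) => // n /= leNn.
    have := norm_le_sqnorm2 (x n); have [_ /ltW] := xP n.
    have := ler_norm N; have : `|N| + 1 < n%:R.
      by apply: lt_le_trans (archi_boundP _) _; rewrite ?addr_ge0 ?ler_nat.
    by move: M0_gt0; lra.
  move=> ltN; have [n [/= /fN nz z]] := filter_ex (filterI ltN f0).
  by move: z nz; rewrite -[meval _ _]/(mpeval _ _) sqnorm_mpolyE => -> /eqP.
Qed.

End MilnorSet.

Theorem lemma3p5 (R : realType) (m p : nat) (hp : (1 <= p)%N) (hpm : (p <= m)%N)
    (Psi : 'rV[R]_m -> 'rV[R]_p) (hPsi : polynomial_map Psi) :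
  let V := Psi @^-1` [set 0] in
  bounded_set (Sing Psi `&` V) ->
  bounded_set (closure (Milnor_set Psi `\` V) `&` V).
Proof.
move=> V bSing; have [P PsiE] := hPsi.
have [M [Mreal MP]] := bounded_Milnor_fiber PsiE bSing.
exists M; split=> // N ltMN x [clx Vx]; apply: (MP N ltMN); split=> //.
(* A closed set contains the closure of each of its subsets, here of the part outside [V]. *)
by apply: (closed_Milnor_set PsiE); apply: closureS clx => y [].
Qed.
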